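(* Let $A=(a_{ij})_{n\times n}$ be a $0$-$1$-matrix and let $\underline{T}=(T_1,\dots,T_n)$ be a contractive $n$-tuple of operators on a Hilbert space $\mathcal{H}$ satisfying $A$-relations. Then the maximal $A$-relation piece of the standard noncommuting dilation (minimal isometric dilation) $\hat{\underline{T}}$ of $\underline{T}$ is a realization of the minimal Cuntz-Krieger dilation $\tilde{\underline{T}}$ of $\underline{T}$.
   Context: All Hilbert spaces are complex and separable. $A=(a_{ij})_{n\times n}$ has entries $a_{ij}\in\{0,1\}$ and each row and each column has at least one non-zero entry. An $n$-tuple $\underline{T}$ of bounded operators is contractive if $\sum_i T_iT_i^*\le I$; it satisfies $A$-relations if $T_iT_j=a_{ij}T_iT_j$ for all $i,j$. Words: $\Lambda=\{1,\dots,n\}$, $\tilde\Lambda=\bigcup_{m\ge0}\Lambda^m$ (with $\Lambda^0=\{0\}$ the empty word); for $\alpha=\alpha_1\cdots\alpha_m$, $\underline{T}^\alpha=T_{\alpha_1}\cdots T_{\alpha_m}$, and $\underline{T}^0=I$. If $\mathcal{H}$ is a closed subspace of $\mathcal{L}$ and $\underline{T},\underline{R}$ are $n$-tuples on $\mathcal{H},\mathcal{L}$, $\underline{R}$ is a dilation of $\underline{T}$ if $R_i^*h=T_i^*h$ for all $h\in\mathcal{H}$ and all $i$. It is minimal if $\overline{\mathrm{span}}\{\underline{R}^\alpha h:\alpha\in\tilde\Lambda,h\in\mathcal{H}\}=\mathcal{L}$. It is isometric if the $R_i$ are isometries with mutually orthogonal ranges. Every contractive tuple has a minimal isometric dilation,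 also called the standard noncommuting dilation, unique up to unitary equivalence. If $\underline{T}$ satisfies $A$-relations, a dilation $\underline{R}$ is a Cuntz-Krieger dilation if the $R_i$ are partial isometries with mutually orthogonal ranges, $\underline{R}$ satisfies $A$-relations, and $R_i^*R_i=I-\sum_{j=1}^n(1-a_{ij})R_jR_j^*$ for all $i$. The minimal Cuntz-Krieger dilation exists and is unique up to unitary equivalence (by a unitary fixing $\mathcal{H}$ pointwise and intertwining the tuples); ''realization'' means a tuple which is a minimal Cuntz-Krieger dilation of $\underline{T}$, i.e. equals $\tilde{\underline{T}}$ up to such unitary equivalence. For an $n$-tuple $\underline{R}$ on $\mathcal{L}$, the maximal $A$-relation subspace $\mathcal{L}_A(\underline{R})$ is the largest closed subspace $\mathcal{M}\subseteq\mathcal{L}$ such that $R_i^*\mathcal{M}\subseteq\mathcal{M}$ for all $i$ and $(R_iR_j-a_{ij}R_iR_j)^*h=0$ for all $h\in\mathcal{M}$ and all $i,j$. The maximal $A$-relation piece $\underline{R}^A$ is the tuple of compressions of the $R_i$ to $\mathcal{L}_A(\underline{R})$. *)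

(* Defs.v *)
From HB Require Import structures.
From mathcomp Require Import all_boot all_order all_algebra.
From mathcomp Require Import sesquilinear complex.
From mathcomp Require Import all_classical all_reals all_analysis.

Set Implicit Arguments.
Unset Strict Implicit.
Unset Printing Implicit Defensive.

Import Order.TTheory GRing.Theory Num.Theory.
Import numFieldNormedType.Exports.

Local Open Scope classical_set_scope.
Local Open Scope ring_scope.

(* Complex separable Hilbert spaces: the norm of the Banach space V is the one
   of a scalar product, which is linear in its first argument. *)
HB.mixin Record CompleteNormedModule_isSepHilbert (R : realType) V
    of CompleteNormedModule R[i] V := {
  inner : {dot V for (@Num.conj R[i])} ;
  sqr_norm_inner : forall x : V, `|x| ^+ 2 = inner x x ;
  sepHilbert_separable : exists D : set V, countable D /\ dense D
}.

#[short(type="sepHilbertType")]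
HB.structure Definition SepHilbert (R : realType) :=
  {V of CompleteNormedModule R[i] V & CompleteNormedModule_isSepHilbert R V}.

Local Notation "''[' x , y ]" := (inner x y) : ring_scope.

Record closedSubspace (R : realType) (L : sepHilbertType R) := ClosedSubspace {
  csub_set :> set L ;
  csub_closed : closed csub_set ;
  csub_submod : submod_closed [pred x | x \in csub_set]
}.

HB.instance Definition _ (R : realType) (L : sepHilbertType R) :=
  gen_eqMixin (closedSubspace L).
HB.instance Definition _ (R : realType) (L : sepHilbertType R) :=
  gen_choiceMixin (closedSubspace L).

Section SubHilbert.
Context (R : realType) (L : sepHilbertType R) (M : closedSubspace L).

Definition csub_pred : {pred L} := [pred x | x \in csub_set M].

HB.instance Definition _ :=
  GRing.isSubmodClosed.Build R[i] L csub_pred (csub_submod M).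

Record subHilbert := SubHilbert {
  csub_val : L ;
  csub_valP : csub_val \in csub_pred
}.

HB.instance Definition _ := [isSub for csub_val].
HB.instance Definition _ := [Choice of subHilbert by <:].
HB.instance Definition _ := [SubChoice_isSubLmodule of subHilbert by <:].

Let norm (x : subHilbert) : R[i] := `|csub_val x|.

Let normD x y : norm (x + y) <= norm x + norm y.
Proof. exact: ler_normD. Qed.

Let normZ l x : norm (l *: x) = `|l| * norm x.
Proof. exact: normrZ. Qed.

Let norm0_eq0 x : norm x = 0 -> x = 0.
Proof. by move=> /normr0_eq0 x0; apply: val_inj; rewrite /= x0. Qed.

HB.instance Definition _ :=
  Lmodule_isNormed.Build R[i] subHilbert normD normZ norm0_eq0.

Let normE (x : subHilbert) : `|x| = `|csub_val x|. Proof. by []. Qed.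

Lemma ball_subHilbert (x y : subHilbert) (e : R[i]) :
  ball x e y <-> ball (csub_val x) e (csub_val y).
Proof. by rewrite -!ball_normE. Qed.

Lemma subHilbert_complete (F : set_system subHilbert) :
  ProperFilter F -> cauchy F -> cvg F.
Proof.
move=> FF /cauchy_ballP Fc.
pose G := csub_val @ F.
have /cauchy_cvg Gcvg : cauchy G.
  apply/cauchy_ballP => e e0.
  have [[A B] /= [FA FB] AB] := Fc e e0.
  exists (csub_val @` A, csub_val @` B) => /=.
    by split; [apply: filterS FA|apply: filterS FB] => z /= Az; exists z.
  move=> [_ _] [/= [a Aa <-] [b Bb <-]].
  by apply/ball_subHilbert; exact: (AB (a, b)).
have Ml : csub_set M (lim G).
  apply: (@closed_cvg _ _ F _ csub_val (csub_set M)) => //.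
  - exact: csub_closed.
  - by apply: nearW => x; have := csub_valP x; rewrite inE.
have Ml' : lim G \in csub_pred by rewrite inE.
apply/cvg_ex; exists (SubHilbert Ml'); apply/cvg_ballP => e e0.
move/cvg_ballP: Gcvg => /(_ _ e0).
by apply: filterS => x lx; apply/ball_subHilbert.
Qed.

HB.instance Definition _ :=
  Uniform_isComplete.Build subHilbert subHilbert_complete.

Definition subHilbert_ip (x y : subHilbert) : R[i] :=
  inner (csub_val x) (csub_val y).

Let linl (u' : subHilbert) : GRing.linear_for *%R (subHilbert_ip ^~ u').
Proof. by move=> a x y; rewrite /subHilbert_ip /= linearPl. Qed.

Let linr u : GRing.linear_for (Num.conj \; *%R) (subHilbert_ip u).
Proof. by move=> a x y; rewrite /subHilbert_ip /= linearPr. Qed.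

HB.instance Definition _ := @bilinear_isBilinear.Build R[i] subHilbert
  subHilbert R[i] *%R (Num.conj \; *%R) subHilbert_ip (linl, linr).

Let herm x y :
  subHilbert_ip x y = (-1) ^+ false * Num.conj (subHilbert_ip y x).
Proof. exact: hermitian_subproof. Qed.

HB.instance Definition _ :=
  @isHermitianSesquilinear.Build R[i] subHilbert false Num.conj
    subHilbert_ip herm.

Let gt0 (x : subHilbert) : x != 0 -> 0 < subHilbert_ip x x.
Proof. by move=> x0; apply: neq0_dnorm_gt0; apply: contra x0. Qed.

HB.instance Definition _ := @isDotProduct.Build R[i] subHilbert
  subHilbert_ip gt0.

Definition subHilbert_inner : {dot subHilbert for (@Num.conj R[i])} :=
  subHilbert_ip.

Lemma subHilbert_sqr_norm (x : subHilbert) :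
  `|x| ^+ 2 = subHilbert_inner x x.
Proof. exact: sqr_norm_inner. Qed.

(* For each point d of a dense sequence and each k, pick a point of M at
   distance less than 1 / (k + 1) of d, if there is one. *)
Lemma subHilbert_separable :
  exists D : set subHilbert, countable D /\ dense D.
Proof.
have [D [cD dD]] := @sepHilbert_separable R L.
pose f (p : L * nat) : subHilbert :=
  xget 0 [set x | ball p.1 (p.2.+1%:R^-1) (csub_val x)].
exists (f @` (D `*` [set: nat])); split.
  by apply: sub_countable (card_image_le _ _) _; exact: countableX.
move=> O [x Ox] Oop.
have /nbhs_ballP[e /= e0 eO] : nbhs x O by exact: open_nbhs_nbhs.
have [k ke] : exists k : nat, k.+1%:R^-1 < e / 2 :> R[i].
  have e2 : 0 < e / 2 by rewrite divr_gt0.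
  have Ee : (complex.Re (e / 2))%:C%C = e / 2 by rewrite RRe_real// gtr0_real.
  move: (e2); rewrite -Ee ltcR => r0.
  have [k _ /(_ k (leqnn k)) kr] := near_infty_natSinv_lt (PosNum r0).
  by exists k; rewrite -(rmorph_nat (real_complex R)) -fmorphV ltcR.
have [d [xd Dd]] : ball (csub_val x) (k.+1%:R^-1) `&` D !=set0.
  apply: dD; last exact: ball_open.
  by exists (csub_val x); exact: ballxx.
exists (f (d, k)); split; last by exists (d, k).
have fdk : ball d k.+1%:R^-1 (csub_val (f (d, k))).
  rewrite /f; case: xgetP => // /(_ x) []/=.
  exact: ball_sym.
apply: eO; apply/ball_subHilbert.
apply: (@ball_split _ _ d); apply: le_ball (ltW ke) _ _ => //.
Qed.

HB.instance Definition _ := @CompleteNormedModule_isSepHilbert.Build R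
  subHilbert subHilbert_inner subHilbert_sqr_norm subHilbert_separable.

End SubHilbert.

Section Operators.
Context (R : realType).
Implicit Types H K L : sepHilbertType R.

Definition bounded_op H K (T : H -> K) : Prop := linear T /\ continuous T.

(* The value is determined by Riesz representation when T is bounded. *)
Definition adjoint H K (T : H -> K) (y : K) : H :=
  xget 0 [set z | forall x, '[T x, y] = '[x, z]].

Definition op_le H (S T : H -> H) : Prop := forall x, 0 <= '[T x - S x, x].

Definition isometric H K (T : H -> K) : Prop :=
  linear T /\ forall x, `|T x| = `|x|.

Definition partial_isometry H K (T : H -> K) : Prop :=
  bounded_op T /\
  forall x, (forall z, T z = 0 -> '[x, z] = 0) -> `|T x| = `|x|.

Definition lin_span L (S : set L) : set L :=
  [set x | exists m (c : 'I_m -> R[i]) (s : 'I_m -> L),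
    (forall k, S (s k)) /\ x = \sum_k c k *: s k].

Definition oproj L (M : closedSubspace L) (x : L) : subHilbert M :=
  xget 0 [set p | forall m : subHilbert M, '[x - csub_val p, csub_val m] = 0].

Definition compression L (M : closedSubspace L) (T : L -> L)
    : subHilbert M -> subHilbert M :=
  fun x => oproj M (T (csub_val x)).

End Operators.

Arguments compression {R L} M T.
Arguments oproj {R L} M x.

Section Tuples.
Context (R : realType) (n : nat).
Implicit Types (H K L : sepHilbertType R) (A : 'M[bool]_n).

Definition bounded_tuple H (T : 'I_n -> H -> H) : Prop :=
  forall i, bounded_op (T i).

Definition contractive H (T : 'I_n -> H -> H) : Prop :=
  op_le (fun x => \sum_i T i (adjoint (T i) x)) id.

Definition satisfies_rel A H (T : 'I_n -> H -> H) : Prop :=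
  forall i j x, T i (T j x) = (A i j)%:R *: T i (T j x).

Definition orthogonal_ranges H (T : 'I_n -> H -> H) : Prop :=
  forall i j, i != j -> forall x y, '[T i x, T j y] = 0.

Definition tuple_word H (T : 'I_n -> H -> H) (alpha : seq 'I_n) : H -> H :=
  foldr (fun i S => T i \o S) id alpha.

(* The isometry V identifies H with a closed subspace of L. *)
Definition is_dilation H L (V : H -> L)
    (T : 'I_n -> H -> H) (S : 'I_n -> L -> L) : Prop :=
  [/\ isometric V, bounded_tuple S &
      forall i h, adjoint (S i) (V h) = V (adjoint (T i) h)].

Definition is_minimal H L (V : H -> L) (S : 'I_n -> L -> L) : Prop :=
  closure (lin_span [set x | exists alpha h, x = tuple_word S alpha (V h)])
  = [set: L].

Definition minimal_isometric_dilation H L (V : H -> L)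
    (T : 'I_n -> H -> H) (S : 'I_n -> L -> L) : Prop :=
  [/\ is_dilation V T S, is_minimal V S,
      forall i, isometric (S i) & orthogonal_ranges S].

Definition minimal_CK_dilation A H L (V : H -> L)
    (T : 'I_n -> H -> H) (S : 'I_n -> L -> L) : Prop :=
  [/\ is_dilation V T S, is_minimal V S,
      (forall i, partial_isometry (S i)) /\ orthogonal_ranges S,
      satisfies_rel A S &
      forall i x, adjoint (S i) (S i x) =
        x - \sum_j (1 - (A i j)%:R) *: S j (adjoint (S j) x)].

Definition unitarily_equivalent_over H K L (V : H -> K) (W : H -> L)
    (S : 'I_n -> K -> K) (S' : 'I_n -> L -> L) : Prop :=
  exists U : K -> L,
    [/\ isometric U, range U = [set: L],
        forall h, U (V h) = W h & forall i x, U (S i x) = S' i (U x)].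

(* The minimal Cuntz-Krieger dilation being defined up to unitary equivalence,
   a realization of it is a minimal Cuntz-Krieger dilation, unitarily
   equivalent to any other one. *)
Definition CK_realization A H L (V : H -> L)
    (T : 'I_n -> H -> H) (S : 'I_n -> L -> L) : Prop :=
  minimal_CK_dilation A V T S /\
  forall K (W : H -> K) (T' : 'I_n -> K -> K), minimal_CK_dilation A W T T' ->
    unitarily_equivalent_over V W S T'.

Definition rel_subspace A L (S : 'I_n -> L -> L) (M : closedSubspace L)
    : Prop :=
  (forall i x, csub_set M x -> csub_set M (adjoint (S i) x)) /\
  (forall i j x, csub_set M x ->
    adjoint (fun y => S i (S j y) - (A i j)%:R *: S i (S j y)) x = 0).

Definition is_max_rel_subspace A L (S : 'I_n -> L -> L) (M : closedSubspace L)
    : Prop :=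
  rel_subspace A S M /\ forall N, rel_subspace A S N -> N `<=` M.

Lemma closedSubspaceT_subproof L :
  submod_closed [pred x | x \in [set: L]].
Proof. by split=> [|a x y _ _]; rewrite !inE. Qed.

Definition closedSubspaceT L : closedSubspace L :=
  ClosedSubspace closedT (@closedSubspaceT_subproof L).

(* The largest subspace always exists for a bounded tuple, so that the default
   value is irrelevant. *)
Definition max_rel_subspace A L (S : 'I_n -> L -> L) : closedSubspace L :=
  xget (closedSubspaceT L) [set M | is_max_rel_subspace A S M].

Definition max_rel_piece A L (S : 'I_n -> L -> L) (i : 'I_n) :=
  compression (max_rel_subspace A S) (S i).

End Tuples.

Arguments max_rel_piece {R n} A {L} S i.

(* Main.v *)
Require Import Defs.
From mathcomp Require Import all_boot all_order all_algebra.
From mathcomp Require Import sesquilinear complex.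
From mathcomp Require Import all_classical all_reals all_analysis.
From mathcomp Require Import ring lra.

(** Write S for the isometric dilation, M for the maximal A-relation subspace,
    P_M for the orthogonal projection onto M, and S_w for the product of the S_i
    along a word w.

    Call a word forbidden if it has two consecutive letters i, j with
    a_ij = 0. The subspace M is explicit: it is the orthogonal complement of the
    ranges of the S_w with w forbidden ([unforbidden_max]). As T_w = 0 for such
    w, and the adjoints of the S_i extend those of the T_i, M contains the copy
    of the space of T ([dilation_range_unforbidden]). The compression of a
    minimal dilation to a subspace that contains this copy and is stable under
    the S_i^* is again a minimal dilation, because P_M then intertwines
    S_i and its compression and maps a total set to a total set
    ([coinvariant_dilation], [coinvariant_minimal]).

    What remains is to compute the piece P_i = P_M S_i. Put
    E_i = I - sum_j (1 - a_ij) S_j S_j^*: this cuts out of a vector the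
    components lying in the ranges of the S_j that may not follow S_i. For x in
    M, S_i E_i x is still in M, as no forbidden word can see it, while
    S_i x - S_i E_i x is a sum of vectors S_i S_j y with a_ij = 0, which are
    orthogonal to M. Hence P_i x = S_i E_i x ([max_rel_piece_act]). Since the
    S_i are isometries with orthogonal ranges, and since P_j P_j^* and
    S_j S_j^* agree on M, this gives P_i^* P_i = E_i on M, the Cuntz-Krieger
    relation ([max_rel_piece_CK]). Together with P_i P_j = a_ij P_i P_j it implies
    P_i (I - P_i^* P_i) = 0, so that the P_i are partial isometries
    ([CK_partial_isometry]).

    Finally, two minimal Cuntz-Krieger dilations of T are unitarily equivalent,
    because the relations determine the inner products of the vectors S_w h, h
    in the space of T ([CK_gram]); an equality of Gram matrices on total
    families extends to a unitary ([isometric_extension]). *)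

Set Implicit Arguments.
Unset Strict Implicit.
Unset Printing Implicit Defensive.

Import Order.TTheory GRing.Theory Num.Theory.
Import numFieldNormedType.Exports.

Local Open Scope classical_set_scope.
Local Open Scope ring_scope.

Local Notation "''[' x , y ]" := (inner x y) : ring_scope.

(** * Inner products *)

Section InnerProduct.
Context (R : realType) (H : sepHilbertType R).
Implicit Types (x y z u m : H) (c : R[i]).

Lemma innerC x y : '[x, y] = ('[y, x])^*.
Proof. by rewrite (hermC inner) expr0 mul1r. Qed.

Lemma inner_eq0C x y : '[x, y] = 0 -> '[y, x] = 0.
Proof. by rewrite innerC => /eqP; rewrite conjC_eq0 => /eqP. Qed.

Lemma inner_normE x : '[x, x] = `|x| ^+ 2.
Proof. by rewrite sqr_norm_inner. Qed.

Lemma inner_inj x y : (forall z, '[z, x] = '[z, y]) -> x = y.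
Proof.
move=> xy; apply/subr0_eq/normr0_eq0/eqP; rewrite -sqrf_eq0 -inner_normE.
by rewrite linearBr /= xy subrr.
Qed.

Lemma sqr_normD x y : '[x, y] = 0 -> `|x + y| ^+ 2 = `|x| ^+ 2 + `|y| ^+ 2.
Proof. by move=> xy; rewrite -!inner_normE hnormDd. Qed.

Lemma parallelogram x y :
  `|x + y| ^+ 2 + `|x - y| ^+ 2 = 2 * `|x| ^+ 2 + 2 * `|y| ^+ 2.
Proof.
by rewrite -!inner_normE !linearDl !linearDr /= !linearNl !linearNr /=; ring.
Qed.

(** The coefficient is given together with [x, m] = a |m|^2, a form which also
    holds when m = 0. *)
Lemma orthogonal_part x m :
  {a | '[x - a *: m, m] = 0 & '[x, m] = a * `|m| ^+ 2}.
Proof.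
have [->|m0] := eqVneq m 0.
  by exists 0; rewrite linear0r // normr0 expr0n mulr0.
exists ('[x, m] / `|m| ^+ 2); last by rewrite divfK// sqrf_eq0 normr_eq0.
rewrite linearBl /= linearZl_LR /= inner_normE divfK ?subrr//.
by rewrite sqrf_eq0 normr_eq0.
Qed.

Lemma pythagoras_part x m a : '[x - a *: m, m] = 0 ->
  `|x| ^+ 2 = `|x - a *: m| ^+ 2 + (`|a| * `|m|) ^+ 2.
Proof.
move=> xm; rewrite -normrZ -sqr_normD ?subrK//.
by rewrite linearZr_LR /= xm mulr0.
Qed.

Lemma cauchy_schwarz x y : `|'[x, y]| <= `|x| * `|y|.
Proof.
have [a xay xyE] := orthogonal_part x y.
have : `|a| * `|y| <= `|x|.
  rewrite -(@ler_pXn2r _ 2)// ?nnegrE ?mulr_ge0//.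
  by rewrite (pythagoras_part xay) lerDr exprn_ge0.
rewrite xyE normrM normrX normr_id => ayx.
by rewrite expr2 mulrA ler_wpM2r.
Qed.

(** Subtracting from u its component along m would shorten u, unless that
    component is zero. *)
Lemma best_approx_orthogonal u m :
  (forall c, `|u| <= `|u - c *: m|) -> '[u, m] = 0.
Proof.
have [a uam ->] := orthogonal_part u m; move=> /(_ a).
rewrite -(@ler_pXn2r _ 2)// ?nnegrE// (pythagoras_part uam).
rewrite gerDl => am; have : (`|a| * `|m|) ^+ 2 == 0.
  by rewrite eq_le am exprn_ge0 ?mulr_ge0.
rewrite sqrf_eq0 mulf_eq0 => /orP[|] /eqP h0.
  by rewrite (normr0_eq0 h0) mul0r.
by rewrite h0 expr0n mulr0.
Qed.

Lemma ball_norm_lt x y e : ball x e y = (`|x - y| < e) :> Prop.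
Proof. by rewrite -ball_normE. Qed.

Lemma bound_continuous (H' : sepHilbertType R) (f : H -> H') (k : R[i]) :
  linear f -> (forall x, `|f x| <= k * `|x|) -> continuous f.
Proof.
move=> fl fk x.
have fB y : f x - f y = f (x - y).
  by rewrite addrC -[- f y]scaleN1r -fl scaleN1r addrC.
apply/cvgrPdist_lt => e e0.
have k1 : 0 < `|k| + 1 by rewrite ltr_pwDr.
near=> y; rewrite fB.
apply: (@le_lt_trans _ _ ((`|k| + 1) * `|x - y|)).
  have [->|xy] := eqVneq x y.
    rewrite (le_trans (fk _))// subrr normr0 !mulr0//.
  have : 0 < `|x - y| by rewrite normr_gt0 subr_eq0.
  move=> xy0; apply: (le_trans (fk _)); apply: ler_wpM2r => //.
  have k0 : 0 <= k.
    by rewrite -(pmulr_lge0 _ xy0) (le_trans _ (fk _)).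
  by rewrite ger0_norm// lerDl.
rewrite mulrC -ltr_pdivlMr//; near: y.
by apply: cvgr_dist_lt => //; rewrite divr_gt0.
Unshelve. all: by end_near. Qed.

Lemma inner_continuous y : continuous (fun x => '[x, y]).
Proof.
move=> x; apply/cvgrPdist_lt => e e0; near=> z.
rewrite -linearBl; apply: (le_lt_trans (cauchy_schwarz _ _)).
apply: (@le_lt_trans _ _ (`|x - z| * (`|y| + 1))).
  by rewrite ler_wpM2l// lerDl.
have y1 : 0 < `|y| + 1 by rewrite ltr_pwDr.
rewrite -ltr_pdivlMr//; near: z.
by apply: cvgr_dist_lt => //; rewrite divr_gt0.
Unshelve. all: by end_near. Qed.

Lemma in_closure_dist (S : set H) x :
  closure S x <-> forall e : R[i], 0 < e -> exists2 y, S y & `|x - y| < e.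
Proof.
split=> [Sx e e0|Sx B /nbhs_ballP[e /= e0 eB]].
  have [y [Sy xy]] := Sx _ (nbhsx_ballx x _ e0).
  by exists y => //; rewrite -ball_norm_lt.
have [y Sy xy] := Sx e e0; exists y; split=> //; apply: eB.
by rewrite /ball_ ball_norm_lt.
Qed.

(** Cantor's intersection principle: the filter generated by the B k is Cauchy.
    Completeness is used only through this lemma. *)
Lemma shrinking_sets_limit (B : nat -> set H) :
    (forall k, B k !=set0) -> (forall k, B k.+1 `<=` B k) ->
    (forall e : R[i], 0 < e ->
      exists k, forall x y, B k x -> B k y -> `|x - y| < e) ->
  exists l, forall k, closure (B k) l.
Proof.
move=> B0 Bd Bs.
have Ble j k : (j <= k)%N -> B k `<=` B j.
  elim: k => [|k IH]; first by rewrite leqn0 => /eqP->.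
  rewrite leq_eqVlt => /orP[/eqP->//|jk]; exact: subset_trans (Bd _) (IH jk).
pose F := filter_from setT B.
have FF : ProperFilter F.
  apply: filter_from_proper => [|//].
  apply: filter_from_filter; first by exists 0%N.
  move=> i j _ _; exists (maxn i j) => // x Bx.
  by split; apply: Ble Bx; rewrite ?leq_maxl ?leq_maxr.
have Fc : cauchy F.
  apply/cauchy_exP => e e0; have [k Bk] := Bs e e0.
  have [x Bx] := B0 k; exists x; exists k => // y By.
  by rewrite ball_norm_lt; exact: Bk.
have /cvg_ex[l Fl] := @cauchy_cvg _ _ FF Fc.
exists l => k A Al; have [j _ jA] := Fl _ Al.
have [x Bx] := B0 (maxn j k).
exists x; split; first by apply: Ble Bx; rewrite leq_maxr.
by apply: jA; apply: Ble Bx; rewrite leq_maxl.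
Qed.

End InnerProduct.

Lemma closed_singleton (K : numFieldType) (V : pseudoMetricNormedZmodType K)
    (v : V) : closed [set v].
Proof. exact/accessible_closed_set1/hausdorff_accessible/norm_hausdorff. Qed.

(** * Orthogonal projections and adjoints *)

Section OrthogonalComplement.
Context (R : realType) (H : sepHilbertType R) (E : set H).

Definition orth_set : set H := [set x | forall z, E z -> '[x, z] = 0].

Lemma orth_set_closed : closed orth_set.
Proof.
have -> : orth_set = \bigcap_(z in E) ((fun x => '[x, z]) @^-1` [set 0]).
  by apply/seteqP; split=> x /=.
apply: closed_bigI => z Ez; apply: closed_comp; last exact: closed_singleton.
by move=> x _; exact: inner_continuous.
Qed.

Lemma orth_set_submod : submod_closed [pred x | x \in orth_set].
Proof.
split=> [|a x y]; first by rewrite inE => z _; rewrite linear0l.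
rewrite !inE => xE yE z Ez.
by rewrite linearPl /= xE// yE// mulr0 addr0.
Qed.

Definition orth_subspace : closedSubspace H :=
  ClosedSubspace orth_set_closed orth_set_submod.

End OrthogonalComplement.

Section Projection.
Context (R : realType) (H : sepHilbertType R) (M : closedSubspace H).

Lemma csub0 : csub_set M 0.
Proof. by have := (csub_submod M).1; rewrite inE. Qed.

Lemma csubP a x y : csub_set M x -> csub_set M y -> csub_set M (a *: x + y).
Proof. by have /= := (csub_submod M).2 a x y; rewrite !inE; apply. Qed.

Lemma csubZ a x : csub_set M x -> csub_set M (a *: x).
Proof.
by move=> Mx; rewrite -[_ *: _]addr0; apply: csubP => //; exact: csub0.
Qed.

Lemma csubD x y : csub_set M x -> csub_set M y -> csub_set M (x + y).
Proof. by move=> Mx My; rewrite -[x]scale1r; exact: csubP. Qed.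

(* R[i] is only partially ordered: the infimum of the distances is taken in R,
   with this real-valued version of the norm. *)
Let rnorm (x : H) : R := complex.Re `|x|.

Let rnormE x : `|x| = (rnorm x)%:C%C.
Proof. by rewrite RRe_real// normr_real. Qed.

Let rnorm_ge0 x : 0 <= rnorm x.
Proof. by rewrite -ler0c -rnormE. Qed.

Let rnorm_parallelogram x y :
  rnorm (x + y) ^+ 2 + rnorm (x - y) ^+ 2 = 2 * rnorm x ^+ 2 + 2 * rnorm y ^+ 2.
Proof.
apply: (@complexI R).
rewrite !rmorphD /= !(rmorphM _ 2) /= !rmorphXn /= -!rnormE.
by rewrite rmorph_nat; exact: parallelogram.
Qed.

(** By the parallelogram law, the points of M whose distance to x exceeds the
    infimum d by less than e are close to each other when e is small. *)
Lemma best_approximation x :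
  exists2 p, csub_set M p & forall m, csub_set M m -> `|x - p| <= `|x - m|.
Proof.
pose D := [set rnorm (x - m) | m in csub_set M].
have D0 : D !=set0 by exists (rnorm (x - 0)), 0 => //; exact: csub0.
have Dlb : has_inf D by split=> //; exists 0 => _ [m _ <-].
pose d := inf D.
have d_le m : csub_set M m -> d <= rnorm (x - m).
  by move=> Mm; apply: ge_inf; [case: Dlb|exists m].
have d0 : 0 <= d by apply: lb_le_inf => // _ [m _ <-].
pose B k := [set m | csub_set M m /\ rnorm (x - m) < d + k.+1%:R^-1].
have Bspread e m m' : 0 <= e <= 1 -> csub_set M m -> csub_set M m' ->
    rnorm (x - m) < d + e -> rnorm (x - m') < d + e ->
    rnorm (m' - m) ^+ 2 <= 4 * e * (2 * d + 1).
  move=> e1 Mm Mm' xm xm'.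
  (* The midpoint of m and m' is in M, hence at distance at least d of x. *)
  have mid : 2 * d <= rnorm ((x - m) + (x - m')).
    have -> : (x - m) + (x - m') = 2 *: (x - 2^-1 *: (m + m')).
      rewrite scalerBr scalerA divff// scale1r scaler_nat mulr2n.
      by rewrite opprD addrACA.
    rewrite -lecR -rnormE normrZ ger0_norm// rmorphM rmorph_nat ler_wpM2l//.
    by rewrite rnormE lecR; apply/d_le/csubZ/csubD.
  have -> : m' - m = (x - m) - (x - m') by rewrite opprB [RHS]addrC addrA subrK.
  have := rnorm_parallelogram (x - m) (x - m').
  have := rnorm_ge0 (x - m); have := rnorm_ge0 (x - m').
  move: (rnorm (_ + _)) mid xm xm' => s.
  move: (rnorm (x - m)) (rnorm (x - m')) => a b.
  move: (rnorm (_ - _)) => t b0 a0 pl sd ae be; case/andP: e1 => e0 e1.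
  have s2 : (2 * d) ^+ 2 <= s ^+ 2 by rewrite ler_pXn2r ?nnegrE//; lra.
  have a2 : a ^+ 2 <= (d + e) ^+ 2 by rewrite ler_pXn2r ?nnegrE//; lra.
  have b2 : b ^+ 2 <= (d + e) ^+ 2 by rewrite ler_pXn2r ?nnegrE//; lra.
  by nra.
have [k|k|e e0|p Bp] := @shrinking_sets_limit R H B.
- have e0 : 0 < k.+1%:R^-1 :> R by rewrite invr_gt0.
  by have [_ [m Mm <-] dm] := inf_adherent e0 Dlb; exists m.
- move=> m [Mm dm]; split=> //; apply: (lt_le_trans dm).
  by rewrite lerD2l lef_pV2 ?posrE// ler_nat.
- pose e' := complex.Re e.
  have eE : e = e'%:C%C by rewrite RRe_real// gtr0_real.
  have e'0 : 0 < e' by move: e0; rewrite eE ltcR.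
  have c0 : 0 < e' ^+ 2 / (4 * (2 * d + 1)).
    by rewrite divr_gt0 ?exprn_gt0// mulr_gt0// ltr_wpDl// mulr_ge0.
  have [k _ /(_ k (leqnn k)) kr] := near_infty_natSinv_lt (PosNum c0).
  exists k => m' m [Mm' xm'] [Mm xm].
  rewrite rnormE eE ltcR -(@ltr_pXn2r _ 2)// ?nnegrE// ?(ltW e'0)//.
  apply: (le_lt_trans (Bspread _ _ _ _ Mm Mm' xm xm')).
    by rewrite invr_ge0 ler0n invf_le1// ler1n.
  move: kr; rewrite /= ltr_pdivlMr ?mulr_gt0 ?ltr_wpDl ?mulr_ge0//.
  by rewrite mulrA [_ * 4]mulrC.
have Mp : csub_set M p.
  apply: (@csub_closed _ _ M) => // A Ap.
  by have [q [[Mq _] Aq]] := Bp 0%N A Ap; exists q.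
exists p => // m Mm; rewrite !rnormE lecR.
apply: (le_trans _ (d_le _ Mm)); apply/ler_addgt0Pr => e e0.
have e2 : 0 < e / 2 by rewrite divr_gt0.
have [k _ /(_ k (leqnn k)) kr] := near_infty_natSinv_lt (PosNum e2).
have [|q [Mq xq] pq] := (in_closure_dist _ _).1 (Bp k) (e / 2)%:C%C.
  by rewrite ltcR.
rewrite -lecR -rnormE (le_trans (ler_distD q _ _))// [`|q - p|]distrC.
move: pq; rewrite !rnormE -rmorphD lecR ltcR => pq.
apply: (le_trans (lerD (ltW xq) (ltW pq))).
by rewrite -addrA lerD2l [leRHS]splitr lerD2r; exact: ltW kr.
Qed.

Lemma orthogonal_projection x :
  exists2 p, csub_set M p & forall m, csub_set M m -> '[x - p, m] = 0.
Proof.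
have [p Mp pbest] := best_approximation x; exists p => // m Mm.
apply: best_approx_orthogonal => c.
by rewrite -addrA -opprD; apply/pbest/csubD => //; exact: csubZ.
Qed.

Lemma oprojP x (m : subHilbert M) : '[x - csub_val (oproj M x), csub_val m] = 0.
Proof.
have [p Mp px] := orthogonal_projection x.
have Mp' : p \in csub_pred M by rewrite inE.
rewrite /oproj; case: xgetP => [q _|/(_ (SubHilbert Mp'))]; first exact.
by case=> m' /=; apply: px; have := csub_valP m'; rewrite inE.
Qed.

End Projection.

Section Adjoint.
Context (R : realType).
Implicit Types H K : sepHilbertType R.

(** Riesz representation: the vector representing a nonzero f is a multiple of
    any nonzero u orthogonal to the kernel, and pairing with u determines the
    multiple. *)
Lemma riesz H (f : H -> R[i]) :
    linear_for *%R f -> closed (f @^-1` [set 0]) ->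
  exists z, forall x, f x = '[x, z].
Proof.
move=> fl fc.
have f0 : f 0 = 0.
  by have := fl (-1) 0 0; rewrite scaler0 addr0 mulN1r addNr.
have fB x y : f (x - y) = f x - f y.
  by rewrite addrC -scaleN1r fl mulN1r addrC.
have fZ a x : f (a *: x) = a * f x by rewrite -[_ *: _]addr0 fl f0 addr0.
have fs : submod_closed [pred x | x \in f @^-1` [set 0]].
  split=> [|a x y]; first by rewrite inE.
  by rewrite !inE /= fl => -> ->; rewrite mulr0 addr0.
have [fT|/existsNP[x0 fx0]] := pselect (forall x, f x = 0).
  by exists 0 => x; rewrite linear0r.
have [p fp px] := orthogonal_projection (ClosedSubspace fc fs) x0.
pose u := x0 - p.
have fu : f u != 0 by rewrite fB fp subr0; exact/eqP.
have uu : '[u, u] != 0.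
  rewrite inner_normE sqrf_eq0 normr_eq0; apply: contra fu => /eqP->.
  by rewrite f0.
exists ((f u / '[u, u])^* *: u) => x.
rewrite linearZr_LR /= conjCK.
have : '[u, x - (f x / f u) *: u] = 0.
  by apply: px => /=; rewrite fB fZ divfK// subrr.
move=> /inner_eq0C; rewrite linearBl /= linearZl_LR /= => /eqP.
rewrite subr_eq0 => /eqP->.
by field; rewrite fu uu.
Qed.

Lemma adjoint_eq H K (T : H -> K) y z :
  (forall x, '[T x, y] = '[x, z]) -> adjoint T y = z.
Proof.
move=> Tz; rewrite /adjoint; case: xgetP => [w _ Tw|/(_ z)//].
by apply: inner_inj => x; rewrite -Tw Tz.
Qed.

Lemma adjointP H K (T : H -> K) : bounded_op T ->
  forall x y, '[T x, y] = '[x, adjoint T y].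
Proof.
move=> [Tl Tc] x y; have [||z zP] := @riesz H (fun x => '[T x, y]).
- by move=> a u v; rewrite Tl linearPl.
- apply: closed_comp; last exact: closed_singleton.
  move=> u _; apply: (@continuous_comp _ _ _ T (fun v => '[v, y])).
    exact: Tc.
  exact: inner_continuous.
by rewrite zP (adjoint_eq zP).
Qed.

Lemma adjointP_l H K (T : H -> K) : bounded_op T ->
  forall x y, '[adjoint T y, x] = '[y, T x].
Proof. by move=> bT x y; rewrite innerC -adjointP// -innerC. Qed.

End Adjoint.

(** * Bounded operators *)

Section LinearMaps.
Context (R : realType).
Implicit Types H K L : sepHilbertType R.

Section OneMap.
Context (H K : sepHilbertType R) (f : H -> K) (fl : linear f).

Lemma linear_map0 : f 0 = 0.
Proof. by have := fl (-1) 0 0; rewrite scaler0 addr0 scaleN1r addNr. Qed.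

Lemma linear_mapD x y : f (x + y) = f x + f y.
Proof. by have := fl 1 x y; rewrite !scale1r. Qed.

Lemma linear_mapZ a x : f (a *: x) = a *: f x.
Proof. by rewrite -[_ *: _]addr0 fl linear_map0 addr0. Qed.

Lemma linear_mapB x y : f (x - y) = f x - f y.
Proof. by rewrite linear_mapD -scaleN1r linear_mapZ scaleN1r. Qed.

Lemma linear_map_sum I (r : seq I) (P : pred I) (F : I -> H) :
  f (\sum_(i <- r | P i) F i) = \sum_(i <- r | P i) f (F i).
Proof. exact: (big_morph f linear_mapD linear_map0). Qed.

End OneMap.

Lemma bounded_op_comp H K L (f : K -> L) (g : H -> K) :
  bounded_op f -> bounded_op g -> bounded_op (f \o g).
Proof.
move=> [fl fc] [gl gc]; split; first by move=> a x y; rewrite /= gl fl.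
by move=> x; apply: continuous_comp; [exact: gc|exact: fc].
Qed.

Lemma isometric_bounded H K (f : H -> K) : isometric f -> bounded_op f.
Proof.
move=> [fl fn]; split=> //; apply: (bound_continuous (k := 1)) => // x.
by rewrite mul1r fn.
Qed.

(** Polarization: comparing the norms of c x + y for c = 1 and c = i gives the
    real and the imaginary part of the inner product. *)
Lemma isometric_inner H K (f : H -> K) : isometric f ->
  forall x y, '[f x, f y] = '[x, y].
Proof.
move=> [fl fn] x y.
have key c : c * '[f x, f y] + (c * '[f x, f y])^*
           = c * '[x, y] + (c * '[x, y])^*.
  have := fn (c *: x + y); move/(congr1 (fun t => t ^+ 2)).
  rewrite fl -!inner_normE !dnormD !dnormZ !inner_normE !fn !linearZl_LR /=.
  by move/addrI.
have k1 := key 1; have ki := key 'i.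
rewrite !mul1r in k1; rewrite !rmorphM /= !conjCi !mulNr in ki.
have {}ki : '[f x, f y] - ('[f x, f y])^* = '[x, y] - ('[x, y])^*.
  by apply: (mulfI (neq0Ci _)); rewrite !mulrBr.
have : 2 * '[f x, f y] = 2 * '[x, y].
  have e2 (u : R[i]) : 2 * u = (u + u^*) + (u - u^*) by ring.
  by rewrite !e2 k1 ki.
by apply: mulfI; rewrite pnatr_eq0.
Qed.

Lemma eq_on_lin_span H K (f g : H -> K) (S : set H) :
    bounded_op f -> bounded_op g -> closure (lin_span S) = setT ->
    (forall x, S x -> f x = g x) ->
  f = g.
Proof.
move=> [fl fc] [gl gc] Sd fg; apply/funext => x.
have /closure_subset : lin_span S `<=` [set x | f x - g x = 0].
  move=> _ [m [c [s [Ss ->]]]] /=.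
  rewrite (linear_map_sum fl) (linear_map_sum gl) -sumrB big1// => k _.
  by rewrite (linear_mapZ fl) (linear_mapZ gl) fg// subrr.
rewrite Sd => /(_ x I) h; apply/subr0_eq; apply: (_ : closed _) h.
apply: (@closed_comp _ _ (fun x => f x - g x) [set 0]).
  2: exact: closed_singleton.
by move=> y _; apply: continuousB; [exact: fc|exact: gc].
Qed.

End LinearMaps.

(** A positive element of R[i] is real, so that k can be found in R. *)
Lemma exists_invS_lt (R : realType) (e : R[i]) : 0 < e ->
  exists k : nat, k.+1%:R^-1 < e.
Proof.
move=> e0; have eE : e = (complex.Re e)%:C%C by rewrite RRe_real// gtr0_real.
move: e0; rewrite eE ltcR => e0.
have [k _ /(_ k (leqnn k)) kr] := near_infty_natSinv_lt (PosNum e0).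
by exists k; rewrite -(rmorph_nat (real_complex R)) -fmorphV ltcR.
Qed.

(** * Extension of an isometry from total families *)

Section IsometricExtension.
Context (R : realType) (D : Type).
Implicit Types K L : sepHilbertType R.

(** A formal linear combination of elements of D is a list of pairs of a
    coefficient and an element; concatenation is its addition. *)
Definition fsum K (f : D -> K) (p : seq (R[i] * D)) : K :=
  \sum_(q <- p) q.1 *: f q.2.

Definition fscale (a : R[i]) (p : seq (R[i] * D)) :=
  [seq (a * q.1, q.2) | q <- p].

Lemma fsum_cat K (f : D -> K) a p q :
  fsum f (fscale a p ++ q) = a *: fsum f p + fsum f q.
Proof.
rewrite /fsum big_cat big_map /= scaler_sumr; congr (_ + _).
by apply: eq_bigr => r _; rewrite scalerA.
Qed.

Lemma lin_span_fsum K (f : D -> K) x :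
  lin_span (range f) x -> exists p, x = fsum f p.
Proof.
move=> [m [c [s [sf ->]]]].
have /choice[d dP] : forall k, exists d, f d = s k.
  by move=> k; have [d _ <-] := sf k; exists d.
exists [seq (c k, d k) | k <- index_enum 'I_m].
by rewrite /fsum big_map; apply: eq_bigr => k _; rewrite dP.
Qed.

(** The pair (x, y) is in the closure of the graph of the map that sends each
    combination of the f a to the same combination of the g a. Working with
    this relation, symmetric in f and g, avoids the choice of approximating
    sequences, and yields the surjectivity of the extension for free. *)
Definition same_limit K L (f : D -> K) (g : D -> L) (x : K) (y : L) :=
  forall e : R[i], 0 < e ->
    exists p, `|x - fsum f p| < e /\ `|y - fsum g p| < e.

Section OneWay.
Context (K L : sepHilbertType R) (f : D -> K) (g : D -> L).
Hypothesis gram : forall a b, '[f a, f b] = '[g a, g b].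

Lemma fsum_norm p : `|fsum f p| = `|fsum g p|.
Proof.
apply/eqP; rewrite -(@eqrXn2 _ 2)// -!inner_normE; apply/eqP.
rewrite /fsum !linear_sumlz; apply: eq_bigr => i _.
rewrite !linear_sumr; apply: eq_bigr => j _.
by rewrite !linearZl_LR !linearZr_LR /= gram.
Qed.

Lemma same_limit_fsum a : same_limit f g (f a) (g a).
Proof.
move=> e e0; exists [:: (1, a)].
by rewrite /fsum !big_seq1 /= !scale1r !subrr !normr0.
Qed.

Lemma same_limit_linear a x y x' y' : same_limit f g x y ->
  same_limit f g x' y' -> same_limit f g (a *: x + x') (a *: y + y').
Proof.
move=> xy xy' e e0; have e2 : 0 < e / 2 by rewrite divr_gt0.
have a0 : 0 < `|a| + 1 by rewrite ltr_pwDr.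
have [p [xp yp]] := xy _ (divr_gt0 e2 a0); have [q [xq yq]] := xy' _ e2.
have aux (V : sepHilbertType R) (u v u' v' : V) :
    `|u - v| < e / 2 / (`|a| + 1) -> `|u' - v'| < e / 2 ->
    `|a *: u + u' - (a *: v + v')| < e.
  move=> uv uv'; rewrite opprD addrACA -scalerBr.
  rewrite (le_lt_trans (ler_normD _ _))//.
  rewrite [ltRHS]splitr ler_ltD// normrZ.
  move: uv; rewrite ltr_pdivlMr// => /ltW; apply: le_trans.
  by rewrite mulrC ler_wpM2l// lerDl.
exists (fscale a p ++ q); rewrite !fsum_cat.
by split; exact: aux.
Qed.

Lemma same_limit_norm x y : same_limit f g x y -> `|x| <= `|y|.
Proof.
move=> xy; apply/ler_addgt0Pr => e e0; have e2 : 0 < e / 2 by rewrite divr_gt0.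
have [p [xp yp]] := xy _ e2.
rewrite -[x](subrK (fsum f p)) (le_trans (ler_normD _ _))// fsum_norm.
rewrite -[fsum g p](subrK y) (le_trans (lerD (ltW xp) (ler_normD _ _)))//.
by rewrite distrC addrA [leRHS]addrC lerD2r [leRHS]splitr lerD2l ltW.
Qed.

(** Approximations of x by combinations of the f a give a Cauchy family of
    combinations of the g a. *)
Lemma same_limit_total : closure (lin_span (range f)) = setT ->
  forall x, exists y, same_limit f g x y.
Proof.
move=> fd x.
pose B k := [set y | exists p, `|x - fsum f p| < k.+1%:R^-1 /\ y = fsum g p].
have [k|k|e e0|y By] := @shrinking_sets_limit R L B.
- have xcl : closure (lin_span (range f)) x by rewrite fd.
  have k0 : 0 < k.+1%:R^-1 :> R[i] by rewrite invr_gt0.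
  have [z /lin_span_fsum[p ->] xp] := (in_closure_dist _ _).1 xcl _ k0.
  by exists (fsum g p), p.
- move=> _ [p [xp ->]]; exists p; split=> //; apply: (lt_le_trans xp).
  by rewrite lef_pV2 ?posrE// ler_nat.
- have e2 : 0 < e / 2 by rewrite divr_gt0.
  have [k ke] := exists_invS_lt e2.
  exists k => _ _ [p [xp ->]] [q [xq ->]].
  have -> : `|fsum g p - fsum g q| = `|fsum f p - fsum f q|.
    have fsumB (V : sepHilbertType R) (h : D -> V) :
        fsum h p - fsum h q = fsum h (fscale (-1) q ++ p).
      by rewrite fsum_cat scaleN1r addrC.
    by rewrite !fsumB fsum_norm.
  rewrite (le_lt_trans (ler_distD x _ _))// distrC [e]splitr.
  by rewrite ltrD// (lt_trans _ ke).
- exists y => e e0; have [k ke] := exists_invS_lt e0.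
  have [_ [p [xp ->]] yp] := (in_closure_dist _ _).1 (By k) e e0.
  by exists p; split=> //; exact: lt_trans ke.
Qed.

End OneWay.

Lemma same_limitC K L (f : D -> K) (g : D -> L) x y :
  same_limit f g x y -> same_limit g f y x.
Proof. by move=> xy e /xy[p [? ?]]; exists p. Qed.

Lemma isometric_extension K L (f : D -> K) (g : D -> L) :
    (forall a b, '[f a, f b] = '[g a, g b]) ->
    closure (lin_span (range f)) = setT ->
    closure (lin_span (range g)) = setT ->
  exists U : K -> L,
    [/\ isometric U, range U = setT & forall a, U (f a) = g a].
Proof.
move=> gram fd gd.
have gramC a b : '[g a, g b] = '[f a, f b] by rewrite gram.
have normE x y : same_limit f g x y -> `|x| = `|y|.
  move=> xy; apply/eqP; rewrite eq_le (same_limit_norm gram xy).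
  by rewrite (same_limit_norm gramC)//; exact: same_limitC.
have uniq x y y' : same_limit f g x y -> same_limit f g x y' -> y = y'.
  move=> xy xy'; have := same_limit_linear (-1) xy' xy.
  rewrite !scaleN1r addNr => /normE; rewrite normr0 => /esym/normr0_eq0.
  by rewrite addrC => /subr0_eq.
have /choice[U UP] := same_limit_total gram fd.
exists U; split.
- split=> [a x y|x]; last by rewrite (normE _ _ (UP x)).
  by apply: uniq (UP _) _; exact: same_limit_linear.
- rewrite -subTset => y _; have [x yx] := same_limit_total gramC gd y.
  by exists x => //; apply: uniq (UP x) _; exact: same_limitC.
- by move=> a; apply: uniq (UP _) _; exact: same_limit_fsum.
Qed.

End IsometricExtension.

(** * Cuntz-Krieger relations and uniqueness of minimal dilations *)

(** By the Cuntz-Krieger and the A-relations, S_i vanishes at x - S_i^* S_i x;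
    if x is orthogonal to the kernel of S_i, then |S_i x|^2 = [x, S_i^* S_i x] =
    |x|^2. *)
Lemma CK_partial_isometry (R : realType) (n : nat) (A : 'M[bool]_n)
    (L : sepHilbertType R) (S : 'I_n -> L -> L) :
    bounded_tuple S -> satisfies_rel A S ->
    (forall i x, adjoint (S i) (S i x) =
      x - \sum_j (1 - (A i j)%:R) *: S j (adjoint (S j) x)) ->
  forall i, partial_isometry (S i).
Proof.
move=> Sb Sr SE i; split=> // x xker.
have ker : S i (x - adjoint (S i) (S i x)) = 0.
  rewrite SE opprB addrC subrK (linear_map_sum (Sb i).1) big1// => j _.
  rewrite (linear_mapZ (Sb i).1) Sr.
  by case: (A i j); rewrite ?subrr ?scale0r ?scaler0.
apply/eqP; rewrite -(@eqrXn2 _ 2)// -!inner_normE adjointP//.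
by rewrite -subr_eq0 -oppr_eq0 opprB -linearBr; apply/eqP/xker.
Qed.

Section Uniqueness.
Context (R : realType) (n : nat) (A : 'M[bool]_n) (H : sepHilbertType R).
Context (T : 'I_n -> H -> H).

Definition word_orbit (L : sepHilbertType R) (V : H -> L) (S : 'I_n -> L -> L)
  (p : seq 'I_n * H) : L := tuple_word S p.1 (V p.2).

Lemma minimal_word_orbit (L : sepHilbertType R) (V : H -> L)
    (S : 'I_n -> L -> L) :
  is_minimal V S = (closure (lin_span (range (word_orbit V S))) = setT).
Proof.
rewrite /is_minimal; congr (closure (lin_span _) = _).
apply/seteqP; split=> x /= => [[a [h ->]]|[[a h] _ <-]]; first by exists (a, h).
by exists a, h.
Qed.

(** In the formula for S_i^* S_i only the term S_k S_k^* survives on the range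
    of S_k, and its coefficient is 1 - a_ik = 0. *)
Lemma CK_source (L : sepHilbertType R) (V : H -> L) (S : 'I_n -> L -> L) i k x :
  minimal_CK_dilation A V T S -> A i k ->
  adjoint (S i) (S i (S k x)) = S k x.
Proof.
move=> [[_ Sb _] _ [_ So] _ SE] Aik; rewrite SE big1 ?subr0// => j _.
have [->|jk] := eqVneq j k; first by rewrite Aik subrr scale0r.
suff -> : adjoint (S j) (S k x) = 0.
  by rewrite (linear_map0 (Sb j).1) scaler0.
by apply: inner_inj => z; rewrite -adjointP// So// linear0r.
Qed.

(** The relations compute the inner products from the T_i alone. A letter facing
    the empty word is moved to the other side as an adjoint, where it acts on
    the space of T as the adjoint of a T_i. Two distinct leading letters give 0.
    Two equal ones give S_i^* S_i. On S_l y this is the identity if a_il = 1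
    ([CK_source]) and 0 otherwise; on V h it gives a combination of vectors V h'
    and S_l V h', so that only the second word gets shorter. Hence the induction
    on the second word, for all first words. *)
Lemma CK_gram (K L : sepHilbertType R) (V : H -> K) (W : H -> L)
    (S : 'I_n -> K -> K) (S' : 'I_n -> L -> L) :
    minimal_CK_dilation A V T S -> minimal_CK_dilation A W T S' ->
  forall p q, '[word_orbit V S p, word_orbit V S q]
            = '[word_orbit W S' p, word_orbit W S' q].
Proof.
move=> SP S'P; have := SP; have := S'P.
move=> [[Wi S'b S'd] _ [_ S'o] S'r S'E] [[Vi Sb Sd] _ [_ So] Sr SE].
move=> [alpha h] [beta k]; rewrite /word_orbit /=.
elim: beta alpha h k => [|j beta IH] alpha h k /=.
  elim: alpha k => [|i alpha IH] k /=; first by rewrite !isometric_inner.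
  by rewrite (adjointP (Sb i)) (adjointP (S'b i)) Sd S'd.
case: alpha => [|i alpha] /=.
  rewrite -(adjointP_l (Sb j)) -(adjointP_l (S'b j)) Sd S'd.
  exact: (IH [::]).
have [<-{j}|ij] := eqVneq i j; last by rewrite So// S'o.
case: alpha => [|l alpha] /=.
  rewrite -(adjointP_l (Sb i)) -(adjointP_l (S'b i)) SE S'E !linearBl /=.
  rewrite (IH [::]) !linear_sumlz.
  congr (_ - _); apply: eq_bigr => l _.
  by rewrite !linearZl_LR /= Sd S'd (IH [:: l]).
have [Ail|/negbTE Ail] := boolP (A i l); last first.
  by rewrite Sr S'r Ail !scale0r !linear0l.
rewrite -(adjointP_l (Sb i)) -(adjointP_l (S'b i)).
by rewrite (CK_source _ SP)// (CK_source _ S'P)// (IH (l :: alpha)).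
Qed.

Lemma minimal_CK_dilation_unique (K L : sepHilbertType R) (V : H -> K)
    (W : H -> L) (S : 'I_n -> K -> K) (S' : 'I_n -> L -> L) :
    minimal_CK_dilation A V T S -> minimal_CK_dilation A W T S' ->
  unitarily_equivalent_over V W S S'.
Proof.
move=> SP S'P; have := SP; have := S'P.
move=> [[_ S'b _] S'm _ _ _] [[_ Sb _] Sm _ _ _].
rewrite !minimal_word_orbit in Sm S'm.
have [U [Ui Us Uo]] := isometric_extension (CK_gram SP S'P) Sm S'm.
exists U; split=> // [h|i x]; first exact: (Uo ([::], h)).
have Ub := isometric_bounded Ui.
suff /(congr1 (@^~ x)) : U \o S i = S' i \o U by [].
apply: eq_on_lin_span Sm _; [exact: bounded_op_comp|exact: bounded_op_comp|].
move=> _ [[a h] _ <-] /=.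
by rewrite (Uo (a, h)); exact: (Uo (i :: a, h)).
Qed.

End Uniqueness.

(** * Compressions to a closed subspace *)

Section Compression.
Context (R : realType) (L : sepHilbertType R) (M : closedSubspace L).
Implicit Types (x y : L) (u v : subHilbert M).

Lemma subHilbertP u : csub_set M (csub_val u).
Proof. by have := csub_valP u; rewrite inE. Qed.

Lemma sub_innerE u v : '[u, v] = '[csub_val u, csub_val v].
Proof. by []. Qed.

Lemma oproj_inner x u : '[oproj M x, u] = '[x, csub_val u].
Proof.
have /eqP := oprojP x u; rewrite linearBl /= subr_eq0 => /eqP->.
exact: sub_innerE.
Qed.

Lemma oproj_eq x u : (forall v, '[x, csub_val v] = '[u, v]) -> oproj M x = u.
Proof.
move=> xu; apply: inner_inj => v.
by rewrite innerC oproj_inner xu -innerC.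
Qed.

Lemma oprojK u : oproj M (csub_val u) = u.
Proof. exact: oproj_eq. Qed.

Lemma oproj_linear : linear (oproj M).
Proof.
move=> a x y; apply: oproj_eq => v.
by rewrite !linearPl /= !oproj_inner.
Qed.

Lemma oproj_norm x : `|oproj M x| <= `|x|.
Proof.
have [->|p0] := eqVneq `|oproj M x| 0; first exact: normr_ge0.
have p_gt0 : 0 < `|oproj M x| by rewrite lt_def p0 normr_ge0.
rewrite -(ler_pM2r p_gt0) -expr2 -inner_normE oproj_inner.
rewrite -[leLHS]ger0_norm ?cauchy_schwarz//.
by rewrite -oproj_inner inner_normE exprn_ge0.
Qed.

Lemma oproj_bounded : bounded_op (oproj M).
Proof.
split; first exact: oproj_linear.
apply: (bound_continuous (k := 1)); first exact: oproj_linear.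
by move=> x; rewrite mul1r oproj_norm.
Qed.

Lemma csub_val_inj : injective (@csub_val R L M).
Proof. exact: val_inj. Qed.

Lemma csub_val_isometric : isometric (@csub_val R L M).
Proof. by []. Qed.

Lemma compression_bounded (T : L -> L) :
  bounded_op T -> bounded_op (compression M T).
Proof.
move=> bT; apply: (bounded_op_comp oproj_bounded).
by apply: (bounded_op_comp bT); exact/isometric_bounded/csub_val_isometric.
Qed.

Section CoInvariant.
Context (T : L -> L) (bT : bounded_op T).
Context (TM : forall x, csub_set M x -> csub_set M (adjoint T x)).

Lemma adjoint_compression u :
  csub_val (adjoint (compression M T) u) = adjoint T (csub_val u).
Proof.
have Tu : adjoint T (csub_val u) \in csub_pred M.
  by rewrite inE; exact/TM/subHilbertP.
rewrite (@adjoint_eq _ _ _ _ _ (SubHilbert Tu))// => v.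
by rewrite /compression oproj_inner adjointP.
Qed.

(** The orthogonal complement of M is stable under T, so that T may be applied
    before or after discarding the component of x in it. *)
Lemma compression_oproj x : compression M T (oproj M x) = oproj M (T x).
Proof.
apply/esym/oproj_eq => v; rewrite /compression oproj_inner !(adjointP bT).
by rewrite -adjoint_compression -oproj_inner sub_innerE.
Qed.

End CoInvariant.

End Compression.

Section CoInvariantPiece.
Context (R : realType) (n : nat) (H L : sepHilbertType R).
Context (V : H -> L) (T : 'I_n -> H -> H) (S : 'I_n -> L -> L).
Context (M : closedSubspace L).
Context (SM : forall i x, csub_set M x -> csub_set M (adjoint (S i) x)).
Context (W : H -> subHilbert M) (WV : forall h, csub_val (W h) = V h).

Let P i := compression M (S i).

Lemma coinvariant_dilation : is_dilation V T S -> is_dilation W T P.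
Proof.
move=> [[Vl Vn] Sb Sd]; split.
- split=> [a x y|x]; last by rewrite -Vn -WV.
  by apply: val_inj; rewrite /= WV Vl -!WV.
- by move=> i; exact: compression_bounded.
- move=> i h; apply: val_inj.
  by rewrite /= (adjoint_compression (Sb i) (@SM i)) !WV Sd.
Qed.

Lemma oproj_word : bounded_tuple S ->
  forall a x, oproj M (tuple_word S a x) = tuple_word P a (oproj M x).
Proof.
move=> Sb; elim=> [//|i a IH] x /=.
by rewrite -(compression_oproj (Sb i) (@SM i)) IH.
Qed.

(** The projection onto M is a contraction, carries the S_w V h to the
    corresponding vectors for the compressions, and fixes M; hence it turns
    approximations in L into approximations in M. *)
Lemma coinvariant_minimal : bounded_tuple S -> is_minimal V S -> is_minimal W P.
Proof.
move=> Sb; rewrite !minimal_word_orbit => Vm; rewrite -subTset => u _.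
apply/in_closure_dist => e e0.
have ucl : closure (lin_span (range (word_orbit V S))) (csub_val u).
  by rewrite Vm.
have [_ [m [c [s [sV ->]]]] us] := (in_closure_dist _ _).1 ucl _ e0.
exists (oproj M (\sum_(k < m) c k *: s k)).
  exists m, c, (fun k => oproj M (s k)); split=> [k|].
    have [[a h] _ <-] := sV k; exists (a, h) => //.
    by rewrite /word_orbit /= oproj_word// -WV oprojK.
  rewrite (linear_map_sum (@oproj_linear _ _ M)); apply: eq_bigr => k _.
  exact: linear_mapZ (@oproj_linear _ _ M) _ _.
rewrite -[X in `|X - _|]oprojK -(linear_mapB (@oproj_linear _ _ M)).
exact: le_lt_trans (oproj_norm _ _) us.
Qed.

End CoInvariantPiece.

(** * The maximal A-relation subspace *)

Section Forbidden.
Context (R : realType) (n : nat) (A : 'M[bool]_n) (L : sepHilbertType R).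
Implicit Types S : 'I_n -> L -> L.

Definition admissible (w : seq 'I_n) := sorted (fun i j => A i j) w.

(** As the orthogonal complement of a set this is a closed subspace. *)
Definition unforbidden S : closedSubspace L :=
  orth_subspace [set x | exists w z, ~~ admissible w /\ x = tuple_word S w z].

Lemma unforbiddenP S x : csub_set (unforbidden S) x <->
  forall w z, ~~ admissible w -> '[x, tuple_word S w z] = 0.
Proof.
split=> [xS w z wf|xS _ [w [z [wf ->]]]]; last exact: xS.
by apply: xS; exists w, z.
Qed.

(** A word stays forbidden when a letter is put in front of it. *)
Lemma unforbidden_coinvariant S : bounded_tuple S ->
  forall i x, csub_set (unforbidden S) x ->
    csub_set (unforbidden S) (adjoint (S i) x).
Proof.
move=> Sb i x /unforbiddenP xS; apply/unforbiddenP => w z wf.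
rewrite (adjointP_l (Sb i)); apply: (xS (i :: w)).
by apply: contra wf => /path_sorted.
Qed.

(** If N satisfies the relations and x is in N, moving the letters of a
    forbidden word w one by one onto x as adjoints keeps x in N, until a
    forbidden pair comes first and kills it. *)
Lemma unforbidden_max S :
  bounded_tuple S -> is_max_rel_subspace A S (unforbidden S).
Proof.
move=> Sb; split=> [|N [NS Nr] x Nx].
  split; first exact: unforbidden_coinvariant.
  move=> i j x /unforbiddenP xS; apply: adjoint_eq => y; rewrite linear0r.
  case Aij: (A i j); first by rewrite scale1r subrr linear0l.
  rewrite scale0r subr0; apply/inner_eq0C/(xS [:: i; j]).
  by rewrite /admissible /= Aij.
apply/unforbiddenP => w z; elim: w x Nx => [//|i [//|j w] IH] x Nx.
rewrite [admissible _]/=; case Aij: (A i j) => /= wf.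
  by rewrite -(adjointP_l (Sb i)) IH//; exact: NS.
have /= := Nr i j x Nx; rewrite Aij => Sij.
have SijE : (fun y => S i (S j y) - 0%:R *: S i (S j y)) = S i \o S j.
  by apply/funext => y; rewrite scale0r subr0.
rewrite SijE in Sij.
by rewrite -(adjointP_l (bounded_op_comp (Sb i) (Sb j))) Sij linear0l.
Qed.

Lemma max_rel_subspaceE S : bounded_tuple S ->
  csub_set (max_rel_subspace A S) = csub_set (unforbidden S).
Proof.
move=> Sb; have [Ur Um] := unforbidden_max Sb.
rewrite /max_rel_subspace; case: xgetP => [M _ [Mr Mm]|/(_ (unforbidden S))].
  by apply/seteqP; split; [exact: Um|exact: Mm].
by case; exact: unforbidden_max.
Qed.

End Forbidden.

(** * The maximal A-relation piece of an isometric tuple *)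

Section RelationPiece.
Context (R : realType) (n : nat) (A : 'M[bool]_n) (L : sepHilbertType R).
Context (S : 'I_n -> L -> L) (Si : forall i, isometric (S i)).
Context (So : orthogonal_ranges S).

Let M := max_rel_subspace A S.
Let P := max_rel_piece A S.

Let Sb : bounded_tuple S.
Proof. by move=> i; exact: isometric_bounded. Qed.

Lemma max_rel_coinvariant i x : csub_set M x -> csub_set M (adjoint (S i) x).
Proof. by rewrite /M max_rel_subspaceE//; exact: unforbidden_coinvariant. Qed.

Lemma max_relP x : csub_set M x <->
  forall w z, ~~ admissible A w -> '[x, tuple_word S w z] = 0.
Proof. by rewrite /M max_rel_subspaceE//; exact: unforbiddenP. Qed.

Lemma max_rel_adjoint i j x : csub_set M x -> ~~ A i j ->
  adjoint (S j) (adjoint (S i) x) = 0.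
Proof.
move=> Mx Aij; apply: inner_inj => z; rewrite linear0r -!adjointP//.
apply/inner_eq0C; apply: ((max_relP _).1 Mx [:: i; j] z).
by rewrite /admissible /= andbT.
Qed.

(** The orthogonal projection E_i whose kernel is spanned by the ranges of the
    S_j with a_ij = 0. *)
Definition cutoff i x := x - \sum_j (1 - (A i j)%:R) *: S j (adjoint (S j) x).

Lemma inner_cutoff i k x z :
  '[S k z, cutoff i x] = (A i k)%:R * '[S k z, x].
Proof.
rewrite /cutoff linearBr /= linear_sumr (bigD1 k)//=.
rewrite big1 => [|j jk]; last first.
  by rewrite linearZr_LR /= So ?mulr0// eq_sym.
rewrite linearZr_LR /= isometric_inner// -adjointP// rmorphB rmorph1 rmorph_nat.
by rewrite addr0 mulrBl mul1r opprB addrCA subrr addr0.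
Qed.

(** Against a forbidden word S_i E_i x can be nonzero only if the word starts
    with i. Its second letter k must then satisfy a_ik = 1, since E_i removes
    the other ranges; so the word without its first letter is still forbidden,
    and orthogonal to x. *)
Lemma cutoff_mem i x : csub_set M x -> csub_set M (S i (cutoff i x)).
Proof.
move=> Mx; apply/max_relP => -[|j [|k w]] z //.
rewrite /admissible /= => wf; apply/inner_eq0C.
have [ji|ji] := eqVneq j i; last by rewrite So.
rewrite {j}ji in wf *; rewrite isometric_inner// inner_cutoff.
case Aik: (A i k); last by rewrite mul0r.
rewrite mul1r; apply/inner_eq0C; apply: ((max_relP _).1 Mx (k :: w) z).
by move: wf; rewrite Aik.
Qed.

(** On M the vector S_i^* x has no component in the ranges that E_i removes. *)
Lemma cutoff_adjoint i x : csub_set M x ->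
  cutoff i (adjoint (S i) x) = adjoint (S i) x.
Proof.
move=> Mx; rewrite /cutoff big1 ?subr0// => j _.
have [Aij|Aij] := boolP (A i j); first by rewrite subrr scale0r.
by rewrite max_rel_adjoint// (linear_map0 (Sb j).1) scaler0.
Qed.

(** The difference S_i x - S_i E_i x is a combination of vectors S_i S_j y with
    a_ij = 0, which are orthogonal to M. *)
Lemma max_rel_piece_act i u : csub_val (P i u) = S i (cutoff i (csub_val u)).
Proof.
have Mu := subHilbertP u.
have Mc : S i (cutoff i (csub_val u)) \in csub_pred M.
  by rewrite inE; exact: cutoff_mem.
rewrite /P /max_rel_piece /compression.
rewrite (@oproj_eq _ _ _ _ (SubHilbert Mc))// => v.
rewrite sub_innerE /= !(adjointP (Sb i)) /cutoff linearBl /= linear_sumlz.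
rewrite big1 ?subr0// => j _; rewrite linearZl_LR /= (adjointP (Sb j)).
have [Aij|Aij] := boolP (A i j); first by rewrite subrr mul0r.
by rewrite max_rel_adjoint ?linear0r ?mulr0//; exact: subHilbertP.
Qed.

Lemma max_rel_piece_adjoint i u :
  csub_val (adjoint (P i) u) = adjoint (S i) (csub_val u).
Proof. exact: (adjoint_compression (Sb i) (@max_rel_coinvariant i)). Qed.

Lemma max_rel_piece_bounded : bounded_tuple P.
Proof. by move=> i; exact: compression_bounded. Qed.

(** Both sides are E_i: the left one because S_i is an isometry, the right one
    because S_j E_j S_j^* = S_j S_j^* on M. *)
Lemma max_rel_piece_CK i u : adjoint (P i) (P i u) =
  u - \sum_j (1 - (A i j)%:R) *: P j (adjoint (P j) u).
Proof.
have vl := (@csub_val_isometric _ _ M).1.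
apply: csub_val_inj; rewrite max_rel_piece_adjoint max_rel_piece_act.
rewrite (linear_mapB vl) (linear_map_sum vl).
under eq_bigr => j _.
  rewrite (linear_mapZ vl) max_rel_piece_act max_rel_piece_adjoint.
  rewrite cutoff_adjoint; last exact: subHilbertP.
  over.
by apply: adjoint_eq => x; rewrite isometric_inner.
Qed.

Lemma max_rel_piece_orthogonal : orthogonal_ranges P.
Proof. by move=> i j ij u v; rewrite sub_innerE !max_rel_piece_act So. Qed.

Lemma max_rel_piece_rel : satisfies_rel A P.
Proof.
move=> i j u; case Aij: (A i j); first by rewrite scale1r.
rewrite scale0r; apply: inner_inj => v; rewrite linear0r; apply: inner_eq0C.
rewrite !(adjointP (max_rel_piece_bounded _)) sub_innerE.
rewrite !max_rel_piece_adjoint max_rel_adjoint ?linear0r ?Aij//.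
exact: subHilbertP.
Qed.

End RelationPiece.

(** The adjoint of S_w acts on V h as that of T_w, which vanishes for a
    forbidden w. *)
Lemma dilation_range_unforbidden (R : realType) (n : nat) (A : 'M[bool]_n)
    (H L : sepHilbertType R) (V : H -> L) (T : 'I_n -> H -> H)
    (S : 'I_n -> L -> L) :
    bounded_tuple T -> satisfies_rel A T -> is_dilation V T S ->
  forall h, csub_set (unforbidden A S) (V h).
Proof.
move=> Tb Tr [[Vl _] Sb Sd] h; apply/unforbiddenP => w z.
elim: w h => [//|i [//|j w] IH] h; rewrite [admissible _ _]/=.
case Aij: (A i j) => /= wf; rewrite -(adjointP_l (Sb i)) Sd; first exact: IH.
rewrite -(adjointP_l (Sb j)) Sd.
suff -> : adjoint (T j) (adjoint (T i) h) = 0.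
  by rewrite (linear_map0 Vl) linear0l.
apply: inner_inj => x; rewrite -(adjointP (Tb j)) -(adjointP (Tb i)).
by rewrite Tr Aij scale0r linear0l linear0r.
Qed.

Theorem theorem14 (R : realType) (n : nat) (A : 'M[bool]_n)
  (Arow : forall i, exists j, A i j) (Acol : forall j, exists i, A i j)
  (H : sepHilbertType R) (T : 'I_n -> H -> H)
  (Tbounded : bounded_tuple T) (Tcontr : contractive T)
  (Trel : satisfies_rel A T)
  (L : sepHilbertType R) (V : H -> L) (That : 'I_n -> L -> L)
  (ThatP : minimal_isometric_dilation V T That) :
  exists W : H -> subHilbert (max_rel_subspace A That),
    (forall h, csub_val (W h) = V h) /\
    CK_realization A W T (max_rel_piece A That).
Proof.
have [That_dil That_min That_iso That_orth] := ThatP.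
have That_b : bounded_tuple That by case: That_dil.
have VM h : V h \in csub_pred (max_rel_subspace A That).
  rewrite inE max_rel_subspaceE//.
  exact: dilation_range_unforbidden That_dil h.
pose W h := SubHilbert (VM h); have WV h : csub_val (W h) = V h by [].
have coinv := @max_rel_coinvariant _ _ A _ _ That_iso.
exists W; split=> //.
suff piece_CK : minimal_CK_dilation A W T (max_rel_piece A That).
  by split=> // K W' T' T'P; exact: minimal_CK_dilation_unique piece_CK T'P.
have piece_b := max_rel_piece_bounded A That_iso.
have piece_rel := max_rel_piece_rel (A := A) That_iso.
have piece_E := max_rel_piece_CK (A := A) That_iso That_orth.
split=> //.
- exact (coinvariant_dilation coinv WV That_dil).
- exact (coinvariant_minimal coinv WV That_b That_min).
- split; last exact: max_rel_piece_orthogonal.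
  exact: CK_partial_isometry piece_b piece_rel piece_E.
Qed.
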